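(* Let $n\ge 2$ be an integer and let $n_1>n_2\ge 1$, $k_1,k_2\ge 1$ be integers with $k_1n_1+k_2n_2=n$, so that $(n_1^{k_1},n_2^{k_2})$ is a partition of $n$ into two different parts. Then $(n_1^{k_1},n_2^{k_2})$ belongs to the orbit of partitions generated by $r/n$ for some integer $r$ with $1\le r<n$ and $\gcd(r,n)=1$ if and only if $\gcd(n_1,n_2)=1$ and $\gcd(k_1,k_2)=1$.
   Context: Notation: $(n_1^{k_1},n_2^{k_2})$ denotes the partition of $k_1n_1+k_2n_2$ having $k_1$ parts equal to $n_1$ and $k_2$ parts equal to $n_2$. Let $\Phi_0=\begin{pmatrix}0&1\\1&1\end{pmatrix}$ and $\Phi_1=\begin{pmatrix}1&0\\1&1\end{pmatrix}$, acting on column vectors. The Farey map is $F:[0,1]\to[0,1]$, $F(x)=(1-x)/x$ for $x\in[1/2,1]$ and $F(x)=x/(1-x)$ for $x\in[0,1/2]$. For a rational $x\in(0,1)$ let $\ell\ge 0$ be least with $F^{\ell}(x)=1/2$; the binary sequence of $x$ is $\sigma(x)=\sigma_1\cdots\sigma_\ell$ where $\sigma_j=0$ if $F^{j-1}(x)\in(1/2,1)$ and $\sigma_j=1$ if $F^{j-1}(x)\in(0,1/2)$. If $x=p/q$ in lowest terms then $(p,q)^T=\Phi_{\sigma_1}\cdots\Phi_{\sigma_\ell}(1,2)^T$. Orbit of partitions: for $n\ge2$, $1\le r<n$, $\gcd(r,n)=1$ and $\sigma(r/n)=\sigma_1\cdots\sigma_\ell$, for each $m=1,\dots,\ell$ write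 $\Phi_{\sigma_1}\cdots\Phi_{\sigma_m}=\begin{pmatrix}h_2(m)&h_1(m)\\k_2(m)&k_1(m)\end{pmatrix}$ and $(n_2(m),n_1(m))^T=\Phi_{\sigma_{m+1}}\cdots\Phi_{\sigma_\ell}(1,2)^T$. Then $n=k_1(m)n_1(m)+k_2(m)n_2(m)$ with $n_1(m)>n_2(m)\ge 1$, giving the partition $(n_1(m)^{k_1(m)},n_2(m)^{k_2(m)})$ of $n$ of generation $m$. The orbit of partitions generated by $r/n$ is the sequence of these partitions for $m=1,\dots,\ell$. *)

(* Defs.v *)
From mathcomp Require Import all_boot all_order all_algebra.

Set Implicit Arguments.
Unset Strict Implicit.
Unset Printing Implicit Defensive.

Import Order.TTheory GRing.Theory Num.Theory.
Local Open Scope ring_scope.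

(* The two branches agree at 1/2; the values outside [0, 1] are irrelevant. *)
Definition farey (x : rat) : rat :=
  if 1 / 2 <= x then (1 - x) / x else x / (1 - x).

Definition first_hit (x : rat) (l : nat) : Prop :=
  iter l farey x = 1 / 2 /\
  forall j : nat, (j < l)%N -> iter j farey x <> 1 / 2.

(* For x in (0, 1), s = sigma(x), with true standing for the digit 1 and
   false for 0; the digit sigma_(j+1) is nth false s j. An orbit in (0, 1)
   stays in (0, 1) until it meets 1/2, so the digits before that are
   determined by the comparison with 1/2. *)
Definition binary_sequence (x : rat) (s : seq bool) : Prop :=
  first_hit x (size s) /\
  forall j : nat, (j < size s)%N ->
    nth false s j = (iter j farey x < 1 / 2).

Definition Phi0 : 'M[nat]_2 :=
  \matrix_(i, j) nth 0%N (nth [::] [:: [:: 0; 1]; [:: 1; 1]]%N i) j.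

Definition Phi1 : 'M[nat]_2 :=
  \matrix_(i, j) nth 0%N (nth [::] [:: [:: 1; 0]; [:: 1; 1]]%N i) j.

Definition Phi (b : bool) : 'M[nat]_2 := if b then Phi1 else Phi0.

Definition Phi_word (s : seq bool) : 'M[nat]_2 := \prod_(b <- s) Phi b.

Definition half_col : 'cV[nat]_2 := \col_i nth 0%N [:: 1; 2]%N i.

(* The partition (n1^k1, n2^k2), as its sequence of parts; it is
   nonincreasing when n2 <= n1. *)
Definition two_part (n1 k1 n2 k2 : nat) : seq nat :=
  nseq k1 n1 ++ nseq k2 n2.

(* Rows and columns are numbered from 0: the bottom row of the prefix product
   is (k2(m), k1(m)), and the column vector is (n2(m), n1(m))^T. *)
Definition gen_partition (s : seq bool) (m : nat) : seq nat :=
  let A := Phi_word (take m s) in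
  let v := Phi_word (drop m s) *m half_col in
  let k2 := A 1 0 in
  let k1 := A 1 1 in
  let n2 := v 0 0 in
  let n1 := v 1 0 in
  two_part n1 k1 n2 k2.

Definition partition_orbit (s : seq bool) : seq (seq nat) :=
  [seq gen_partition s m | m <- iota 1 (size s)].

Definition in_orbit_of (r n : nat) (p : seq nat) : Prop :=
  exists2 s : seq bool,
    binary_sequence (r%:R / n%:R) s & p \in partition_orbit s.

(* Main.v *)
Require Import Defs.
From mathcomp Require Import all_boot all_order all_algebra.
From mathcomp Require Import zify ring.

(** Multiplying by [Phi b] performs one step of the subtractive Euclidean
    algorithm backwards, on the right for the bottom row of a matrix and on the
    left for a column.  Hence the bottom rows of nonempty words are exactly the
    coprime pairs of positive integers, and the columns [Phi_word s *m half_col]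
    exactly the coprime pairs (n2, n1) with 0 < n2 < n1.  Given both coprimality
    conditions, concatenating a word for (k2, k1) with a word for (n2, n1) yields
    a word s, and s is the binary sequence of the ratio of the entries of
    [Phi_word s *m half_col] because the Farey map removes its first letter. *)

Set Implicit Arguments.
Unset Strict Implicit.
Unset Printing Implicit Defensive.

Import Order.TTheory GRing.Theory Num.Theory.

Lemma coprimeDl m n : coprime (m + n) m = coprime n m.
Proof. by rewrite ![coprime _ m]coprime_sym /coprime gcdnDl. Qed.

Lemma coprimeDr m n : coprime (m + n) n = coprime m n.
Proof. by rewrite addnC coprimeDl. Qed.

Lemma coprimeBl m n : n <= m -> coprime (m - n) n = coprime m n.
Proof. by move=> le_nm; rewrite -coprimeDr subnK. Qed.

(** For the whole word this column is the reduced fraction that generates the orbit, numerator on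
    top; for the suffix left after m letters it is (n2, n1). *)
Definition word_col (s : seq bool) : 'cV[nat]_2 := (Phi_word s *m half_col)%R.

Lemma mulmx2E m p (A : 'M[nat]_(m, 2)) (B : 'M[nat]_(2, p)) i j :
  (A *m B)%R i j = A i 0%R * B 0%R j + A i 1%R * B 1%R j.
Proof.
rewrite mxE !big_ord_recl big_ord0 addr0.
by rewrite (_ : lift _ _ = 1%R :> 'I_2) //; exact/val_inj.
Qed.

Lemma mulmx_Phi_row (A : 'M[nat]_2) b :
  (A *m Phi b)%R 1%R 0%R = (if b then A 1%R 0%R + A 1%R 1%R else A 1%R 1%R) /\
  (A *m Phi b)%R 1%R 1%R = (if b then A 1%R 1%R else A 1%R 0%R + A 1%R 1%R).
Proof. by case: b; rewrite !mulmx2E !mxE /=; lia. Qed.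

Lemma mulmx_Phi_col (v : 'cV[nat]_2) b :
  (Phi b *m v)%R 0%R 0%R = (if b then v 0%R 0%R else v 1%R 0%R) /\
  (Phi b *m v)%R 1%R 0%R = v 0%R 0%R + v 1%R 0%R.
Proof. by case: b; rewrite !mulmx2E !mxE /=; lia. Qed.

Lemma Phi_word_cat s t : Phi_word (s ++ t) = (Phi_word s *m Phi_word t)%R.
Proof. by rewrite /Phi_word big_cat. Qed.

Lemma Phi_word_seq1 b : Phi_word [:: b] = Phi b.
Proof. by rewrite /Phi_word big_seq1. Qed.

Lemma word_col_cat s t : word_col (s ++ t) = (Phi_word s *m word_col t)%R.
Proof. by rewrite /word_col Phi_word_cat mulmxA. Qed.

Lemma word_col_cons b s :
  word_col (b :: s) 0%R 0%R = (if b then word_col s 0%R 0%R else word_col s 1%R 0%R)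
  /\ word_col (b :: s) 1%R 0%R = word_col s 0%R 0%R + word_col s 1%R 0%R.
Proof. by rewrite -cat1s word_col_cat Phi_word_seq1; exact: mulmx_Phi_col. Qed.

Lemma word_col_nil : word_col [::] 0%R 0%R = 1 /\ word_col [::] 1%R 0%R = 2%N.
Proof. by rewrite /word_col /Phi_word big_nil mul1mx !mxE. Qed.

Lemma word_col_coprime s :
  [/\ 0 < word_col s 0%R 0%R, word_col s 0%R 0%R < word_col s 1%R 0%R
    & coprime (word_col s 1%R 0%R) (word_col s 0%R 0%R)].
Proof.
elim: s => [|b s [p_gt0 ltpq cpq]]; first by have [-> ->] := word_col_nil.
have [-> ->] := word_col_cons b s; case: b; split; try lia.
  by rewrite coprimeDl.
by rewrite coprimeDr coprime_sym.
Qed.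

Lemma word_col_surj p q : 0 < p < q -> coprime q p ->
  exists s, word_col s 0%R 0%R = p /\ word_col s 1%R 0%R = q.
Proof.
have [k] := ubnP q; elim: k p q => // k IHk p q ltqk /andP[p_gt0 ltpq] cqp.
(* The smaller and the larger of p and q - p form the column left after the first letter. At q = 2p,
   where [gt2p] is the equality, coprimality forces (p, q) = (1, 2), the empty word. *)
have [eq2p|lt2p|gt2p] := ltngtP q (p + p); last first.
- exists [::]; have [-> ->] := word_col_nil.
  by move: cqp; rewrite gt2p coprimeDl /coprime gcdnn => /eqP->.
- have [|||s [sp sq]] := IHk p (q - p); try lia.
    by rewrite coprimeBl // ltnW.
  exists (true :: s); have [-> ->] := word_col_cons true s.
  by rewrite sp sq; lia.
have [|||s [sp sq]] := IHk (q - p) p; try lia.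
  by rewrite coprime_sym coprimeBl // ltnW.
exists (false :: s); have [-> ->] := word_col_cons false s.
by rewrite sp sq; lia.
Qed.

Lemma Phi_word_rcons s b :
  Phi_word (rcons s b) 1%R 0%R =
    (if b then Phi_word s 1%R 0%R + Phi_word s 1%R 1%R else Phi_word s 1%R 1%R) /\
  Phi_word (rcons s b) 1%R 1%R =
    (if b then Phi_word s 1%R 1%R else Phi_word s 1%R 0%R + Phi_word s 1%R 1%R).
Proof. by rewrite -cats1 Phi_word_cat Phi_word_seq1; exact: mulmx_Phi_row. Qed.

Lemma Phi_word_nil_row : Phi_word [::] 1%R 0%R = 0 /\ Phi_word [::] 1%R 1%R = 1.
Proof. by rewrite /Phi_word big_nil !mxE. Qed.

(** The empty word has bottom row (0, 1); each further letter turns (k2, k1) into k1 and k1 + k2 in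
    some order. *)
Lemma Phi_word_row_coprime s :
  [/\ s != [::] -> 0 < Phi_word s 1%R 0%R, 0 < Phi_word s 1%R 1%R
    & coprime (Phi_word s 1%R 1%R) (Phi_word s 1%R 0%R)].
Proof.
elim/last_ind: s => [|s b [_ k1_gt0 ck]]; first by have [-> ->] := Phi_word_nil_row.
have [-> ->] := Phi_word_rcons s b; case: b; split; try lia.
  by rewrite coprime_sym coprimeDr coprime_sym.
by rewrite coprimeDr coprime_sym.
Qed.

Lemma Phi_word_row_surj k1 k2 : 0 < k1 -> 0 < k2 -> coprime k1 k2 ->
  exists s, [/\ s != [::], Phi_word s 1%R 0%R = k2 & Phi_word s 1%R 1%R = k1].
Proof.
have [k] := ubnP (k1 + k2).
elim: k k1 k2 => // k IHk k1 k2 ltk k1_gt0 k2_gt0 ck.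
have [lt12|lt21|eq12] := ltngtP k1 k2; last first.
(* Equal coprime entries are 1. Both [Phi0] and [Phi1] have bottom row (1, 1), so either letter
   would serve. *)
- exists [:: true]; move: ck; rewrite -eq12 /coprime gcdnn => /eqP->.
  have := Phi_word_rcons [::] true.
  by have [-> ->] := Phi_word_nil_row; case=> -> ->.
- have [||||s [_ s2 s1]] := IHk k2 (k1 - k2); try lia.
    by rewrite coprime_sym coprimeBl // ltnW.
  exists (rcons s false); have [-> ->] := Phi_word_rcons s false.
  by rewrite s1 s2; split; [case: (s) | lia | lia].
have [||||s [_ s2 s1]] := IHk k1 (k2 - k1); try lia.
  by rewrite coprime_sym coprimeBl 1?coprime_sym // ltnW.
exists (rcons s true); have [-> ->] := Phi_word_rcons s true.
by rewrite s1 s2; split; [case: (s) | lia | lia].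
Qed.

Lemma ltr_half_ratio (p q : nat) : 0 < q ->
  (p%:R / q%:R < 1 / 2 :> rat)%R = (p + p < q).
Proof.
move=> q_gt0; rewrite ltr_pdivrMr ?ltr0n // mulrAC mul1r ltr_pdivlMr ?ltr0n //.
by rewrite -natrM ltr_nat muln2 addnn.
Qed.

Lemma eqr_half_ratio (p q : nat) : 0 < q ->
  (p%:R / q%:R == 1 / 2 :> rat)%R = (p + p == q).
Proof.
move=> q_gt0; rewrite eqr_div ?pnatr_eq0 -?lt0n // mul1r -natrM eqr_nat.
by rewrite muln2 addnn.
Qed.

(** On fractions the Farey map is one subtractive Euclidean step, so it undoes [word_col_cons]. *)
Lemma farey_ratio (p q : nat) : 0 < p < q ->
  farey (p%:R / q%:R)%R =
    (if (p + p < q)%N then p%:R / (q - p)%N%:R else (q - p)%N%:R / p%:R)%R.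
Proof.
case/andP=> p_gt0 ltpq; have q_gt0 : 0 < q by lia.
rewrite /farey leNgt ltr_half_ratio // -if_neg negbK natrB ?(ltnW ltpq) //.
have p0 : (p%:R != 0 :> rat)%R by rewrite pnatr_eq0; lia.
have q0 : (q%:R != 0 :> rat)%R by rewrite pnatr_eq0; lia.
have qp0 : (q%:R - p%:R != 0 :> rat)%R by rewrite subr_eq0 eqr_nat; lia.
by case: ifP => _; field; rewrite ?p0 ?q0 ?qp0.
Qed.

Lemma binary_sequence_cons x b s : x != (1 / 2)%R -> b = (x < 1 / 2)%R ->
  binary_sequence (farey x) s -> binary_sequence x (b :: s).
Proof.
move=> /eqP x_neq def_b [[hit min_hit] digits].
split; first split => [|[|j] ltj]; rewrite ?iterSr //.
  exact: min_hit.
by case=> [|j] ltj //=; rewrite -iterS iterSr; exact: digits.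
Qed.

Lemma binary_sequence_word_col s :
  binary_sequence ((word_col s 0 0)%:R / (word_col s 1 0)%:R)%R s.
Proof.
elim: s => [|b s IHs]; first by have [-> ->] := word_col_nil.
have [p_gt0 ltpq _] := word_col_coprime s.
have [-> ->] := word_col_cons b s.
move: (word_col s 0%R 0%R) (word_col s 1%R 0%R) => p q in IHs p_gt0 ltpq *.
(* The fraction is p / (p + q) or q / (p + q) according to [b]; as p < q, these lie strictly below
   and strictly above 1/2. *)
apply: binary_sequence_cons.
- by rewrite eqr_half_ratio; case: (b); lia.
- by rewrite ltr_half_ratio; case: (b); lia.
rewrite farey_ratio; last by case: (b); lia.
case: b; last by rewrite ifF ?addnK //; lia.
by rewrite ifT ?addKn //; lia.
Qed.

(** The first and last parts give n1 and n2; as these differ, counting each gives its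
    multiplicity. *)
Lemma two_part_inj n1 k1 n2 k2 n1' k1' n2' k2' :
    n2 < n1 -> n2' < n1' -> 0 < k1 -> 0 < k2 -> 0 < k1' -> 0 < k2' ->
    two_part n1 k1 n2 k2 = two_part n1' k1' n2' k2' ->
  [/\ n1 = n1', k1 = k1', n2 = n2' & k2 = k2'].
Proof.
move=> lt21 lt21' k1_gt0 k2_gt0 k1'_gt0 k2'_gt0 eqp.
have eqn1 : n1 = n1'.
  by case: k1 k1' k1_gt0 k1'_gt0 eqp => [|k1] [|k1'] // _ _ [].
have eqn2 : n2 = n2'.
  case: k2 k2' k2_gt0 k2'_gt0 eqp => [|k2] [|k2'] // _ _.
  move=> /(congr1 (last 0)); rewrite /two_part !last_cat /=.
  (* Each default is now the repeated value itself, so both branches of [nth_nseq] agree. *)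
  by rewrite -!(nth_last _ (nseq _ _)) !size_nseq !nth_nseq; do !case: ifP.
subst n1' n2'.
have := congr1 (count_mem n1) eqp; have := congr1 (count_mem n2) eqp.
rewrite /two_part !count_cat !count_nseq /= !eqxx.
by rewrite (gtn_eqF lt21) (ltn_eqF lt21); split => //; lia.
Qed.

Theorem theorem4p4 (n n1 n2 k1 k2 : nat) (hn : 2 <= n)
    (hn12 : n2 < n1) (hn2 : 1 <= n2) (hk1 : 1 <= k1) (hk2 : 1 <= k2)
    (hsum : k1 * n1 + k2 * n2 = n) :
  (exists r : nat,
     [/\ 1 <= r < n, coprime r n & in_orbit_of r n (two_part n1 k1 n2 k2)])
  <-> (coprime n1 n2 /\ coprime k1 k2).
Proof.
split=> [[r [_ _ [s _ /mapP[m]]]]|[cn ck]].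
  rewrite mem_iota add1n ltnS => /andP[m_gt0 lem]; rewrite /gen_partition.
  rewrite -/(word_col _).
  (* The prefix, nonempty as m >= 1, controls the multiplicities; the suffix controls the parts. *)
  have [k2_gt0 k1_gt0 ck] := Phi_word_row_coprime (take m s).
  have [n2_gt0 ltn cn] := word_col_coprime (drop m s).
  have {}k2_gt0 := k2_gt0 _.
  case/two_part_inj => // [|-> -> -> ->] //.
  apply: k2_gt0; rewrite -size_eq0 size_takel //; lia.
have [s [s_neq0 s2 s1]] := Phi_word_row_surj hk1 hk2 ck.
have [|t [t2 t1]] := word_col_surj (p := n2) (q := n1) _ cn; first by rewrite hn2.
have [r_gt0 ltrn crn] := word_col_coprime (s ++ t).
(* The bottom entry is the row (k2, k1) times the column (n2, n1); the top entry will be r. *)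
have def_n : word_col (s ++ t) 1%R 0%R = n.
  by rewrite word_col_cat mulmx2E s1 s2 t1 t2 addnC.
exists (word_col (s ++ t) 0%R 0%R); split; first by rewrite r_gt0 -def_n.
  by rewrite coprime_sym -def_n.
exists (s ++ t); first by rewrite -def_n; exact: binary_sequence_word_col.
(* Cutting at the junction of [s] and [t] recovers the given partition. *)
apply/mapP; exists (size s).
  by rewrite mem_iota add1n ltnS size_cat leq_addr lt0n size_eq0 s_neq0.
rewrite /gen_partition take_size_cat // drop_size_cat // -/(word_col _).
by rewrite s1 s2 t1 t2.
Qed.
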